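(* For every $p=2+\rho>2$ there exist a continuously differentiable function $g:\mathbb R\to[0,\infty)$ with Lipschitz derivative that is coercive, satisfies $\liminf_{|\theta|\to\infty}|g'(\theta)|>0$, and whose set of critical values $\{g(\theta):g'(\theta)=0\}$ is nowhere dense in $\mathbb R$; deterministic parameters $\theta_1\in\mathbb R$, $S_0>0$, $\alpha_0>0$ and a constant $\delta_0>0$; and an adapted stochastic-gradient oracle $\{G_n\}_{n\ge1}$ for the AdaGrad-Norm recursion $$S_n=S_{n-1}+G_n^2,\qquad \theta_{n+1}=\theta_n-\frac{\alpha_0}{\sqrt{S_n}}G_n,\qquad n\ge1,$$ such that: (a) $\mathbb E[G_n\mid\mathscr F_{n-1}]=g'(\theta_n)$ for every $n\ge1$; (b) there are $\beta,\sigma\ge0$ with $\mathbb E[G_n^2\mid\mathscr F_{n-1}]\le\beta|g'(\theta_n)|^2+\sigma^2$ for every $n\ge1$; (c) there is a constant $C<\infty$ with $\mathbb E[|G_n|^p\mid\mathscr F_{n-1}]\le C$ on $\{|g'(\theta_n)|\le\delta_0\}$ for every $n\ge1$; and the iterates $\{\theta_n\}$ are bounded, but almost surely $g'(\theta_n)$ does not converge to $0$.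
   Context: The oracle is adapted: there is a probability space with a filtration $\{\mathscr F_n\}_{n\ge0}$ such that, for every $n\ge1$, $\theta_n$ and $S_{n-1}$ are $\mathscr F_{n-1}$-measurable and $G_n$ is $\mathscr F_n$-measurable. The conditional law of $G_n$ given $\mathscr F_{n-1}$ is allowed to depend on the past (including on $S_{n-1}$). *)

(* Defs.v *)
From mathcomp Require Export all_boot all_order all_algebra.
From mathcomp Require Export all_classical all_reals all_analysis.
From mathcomp Require Export measurable_realfun.
Export Order.TTheory GRing.Theory Num.Theory.
Export numFieldNormedType.Exports.

Set Implicit Arguments.
Unset Strict Implicit.
Unset Printing Implicit Defensive.

Local Open Scope ring_scope.
Local Open Scope classical_set_scope.

Definition nowhere_dense (X : topologicalType) (A : set X) : Prop :=
  interior (closure A) = set0.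

(* The filter of neighbourhoods of infinity, i.e. |x| -> oo. *)
Definition norm_pinfty (R : realType) : set_system R :=
  [set A | exists M : R, forall x, M < `|x| -> A x].

Arguments norm_pinfty R : clear implicits.

Definition coercive (R : realType) (g : R -> R) : Prop :=
  g @ norm_pinfty R --> +oo%R.

Definition critical_values (R : realType) (g : R -> R) : set R :=
  [set y | exists2 x : R, derive1 g x = 0 & g x = y].

Definition adapted_measurable (T : Type) (F : set_system T) d'
    (U : measurableType d') (f : T -> U) : Prop :=
  forall B : set U, measurable B -> F (f @^-1` B).

Record is_filtration d (T : measurableType d) (F : nat -> set_system T) :
    Prop := IsFiltration {
  filtration_sigma : forall n, sigma_algebra setT (F n) ;
  filtration_sub : forall n, F n `<=` measurable ;
  filtration_homo : forall m n, (m <= n)%N -> F m `<=` F n }.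

(* [is_cond_exp P F X Y]: Y is a version of E[X | F], for X integrable. *)
Definition is_cond_exp d (T : measurableType d) (R : realType)
    (P : probability T R) (F : set_system T) (X Y : T -> R) : Prop :=
  [/\ P.-integrable setT (EFin \o X),
      P.-integrable setT (EFin \o Y),
      adapted_measurable F Y &
      forall A, F A ->
        (\int[P]_(w in A) (Y w)%:E = \int[P]_(w in A) (X w)%:E)%E].

(* [is_cond_exp_ge0 P F X Y]: Y is a version of E[X | F] for X nonnegative and
   measurable; X need not be integrable, so Y takes its values in [0, +oo]. *)
Definition is_cond_exp_ge0 d (T : measurableType d) (R : realType)
    (P : probability T R) (F : set_system T) (X : T -> R) (Y : T -> \bar R) :
    Prop :=
  [/\ measurable_fun setT X /\ (forall w, 0 <= X w),
      (forall w, (0 <= Y w)%E),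
      adapted_measurable F Y &
      forall A, F A ->
        (\int[P]_(w in A) Y w = \int[P]_(w in A) (X w)%:E)%E].

(* Only G n and theta n with 1 <= n are meaningful; G 0 and theta 0 are
   unconstrained. *)
Record adagrad_norm (R : realType) (T : Type) (alpha0 S0 theta1 : R)
    (G S theta : nat -> T -> R) : Prop := AdagradNorm {
  adagrad_S0 : forall w, S 0%N w = S0 ;
  adagrad_theta1 : forall w, theta 1%N w = theta1 ;
  adagrad_S : forall n w, (1 <= n)%N -> S n w = S n.-1 w + G n w ^+ 2 ;
  adagrad_theta : forall n w, (1 <= n)%N ->
    theta n.+1 w = theta n w - alpha0 / Num.sqrt (S n w) * G n w }.

Record adapted_oracle (R : realType) (T : Type) (F : nat -> set_system T)
    (G S theta : nat -> T -> R) : Prop := AdaptedOracle {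
  oracle_theta : forall n, (1 <= n)%N -> adapted_measurable (F n.-1) (theta n) ;
  oracle_S : forall n, (1 <= n)%N -> adapted_measurable (F n.-1) (S n.-1) ;
  oracle_G : forall n, (1 <= n)%N -> adapted_measurable (F n) (G n) }.

(* Main.v *)
Require Import Defs.
From mathcomp Require Import ring lra.

(** The objective is [x ^+ 2 / 2], whose derivative is the identity, and the
    oracle returns [theta + xi], where the noise [xi] is symmetric and rare.
    When the iterate is within [1 / 4] of the critical point, [xi] is
    [2 * Num.sqrt s] or its opposite, with probability [(2 * Num.sqrt s) `^ (- p)]
    each, and zero otherwise, where [s] is the current sum of squared gradients.
    When the iterate is farther away, there is no noise.

    This law keeps the conditional [p]-th moment of the gradient bounded
    ([moment_gradient]), and the second moment too as [p > 2]
    ([second_moment_gradient]).  But the noise is as large as the normalisation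
    of the step, so a noisy step starting near the critical point moves the
    iterate by at least [1 / 2] ([kick_escapes]).

    Such steps recur although their rate decreases with [s], because [s] stays
    bounded until the next of them.  Indeed, a noiseless step is a step of
    normalised gradient descent, along which [Num.sqrt s + theta ^+ 2] does not
    increase ([quiet_potential]); so on a noiseless path [s] is bounded and the rate of
    the noise is bounded below ([kick_rate_quiet]).  A noiseless future thus has
    probability zero after every history, and nonzero signs are drawn infinitely
    often almost surely ([infinitely_many_draws]).  If the derivatives tended to zero,
    the noise would eventually be switched on at all times, and the next draw
    would push the iterate away.

    The law of each draw depends on the history, and the draws are realised on
    the unit interval with the uniform probability: the interval attached to a
    history is cut into three intervals, whose lengths are proportional to the
    conditional probabilities of the next draw ([history_cylinder],
    [prob_history]).  The history up to a given time then takes finitely many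
    values, and conditional expectations are finite sums ([cond_exp_history]). *)

Set Implicit Arguments.
Unset Strict Implicit.
Unset Printing Implicit Defensive.

Local Open Scope ring_scope.
Local Open Scope classical_set_scope.

(** * A process of rare random signs on the unit interval *)

Definition uniform01 (R : realType) : probability _ R := uniform_prob (@ltr01 R).

Section lazy_signs.
Variables (R : realType) (q : seq (option bool) -> R).
Local Notation P := (uniform01 R).
Hypothesis q_ge0 : forall h, 0 <= q h.
Hypothesis q_le : forall h, 2 * q h <= 1.

(** A history lists the past draws, the most recent one first.  After the
    history [h], the next draw is [Some true] or [Some false], with probability
    [q h] each, or else [None], which stands for the absence of noise. *)
Definition draw_prob (h : seq (option bool)) (d : option bool) : R :=
  if d is Some _ then q h else 1 - 2 * q h.

(** The probability of the draws that come before [d] when the interval of a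
    history is cut into its three children, listed from left to right. *)
Definition offset (h : seq (option bool)) (d : option bool) : R :=
  match d with
  | Some true => 0
  | Some false => q h
  | None => 2 * q h
  end.

Fixpoint width (h : seq (option bool)) : R :=
  if h is d :: h' then width h' * draw_prob h' d else 1.

Fixpoint start (h : seq (option bool)) : R :=
  if h is d :: h' then start h' + width h' * offset h' d else 0.

Definition cylinder h : set R := `[start h, start h + width h[.

Definition draw (h : seq (option bool)) (w : R) : option bool :=
  if w < start h + width h * q h then Some true
  else if w < start h + width h * (2 * q h) then Some false
  else None.

Fixpoint history n (w : R) : seq (option bool) :=
  if n is m.+1 then draw (history m w) w :: history m w else [::].

Lemma size_history n w : size (history n w) = n.
Proof. by elim: n => //= n ->. Qed.

Lemma draw_prob_ge0 h d : 0 <= draw_prob h d.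
Proof. by case: d => [b|] /=; have := q_ge0 h; have := q_le h; lra. Qed.

Lemma width_ge0 h : 0 <= width h.
Proof. by elim: h => //= d h IH; rewrite mulr_ge0 // draw_prob_ge0. Qed.

Lemma widths_ge0 h : 0 <= width h * q h /\ 0 <= width h * (1 - 2 * q h).
Proof.
have := q_le h; have := q_ge0 h; have := width_ge0 h => ? ? ?.
by split; rewrite mulr_ge0 //; lra.
Qed.

Lemma cylinderE h w : cylinder h w = (start h <= w < start h + width h) :> Prop.
Proof. by rewrite /cylinder /= in_itv. Qed.

Lemma draw_cylinder h d w :
  cylinder h w -> (draw h w = d) <-> cylinder (d :: h) w.
Proof.
rewrite !cylinderE /= /draw => /andP[h1 h2].
have [wq wq2] := widths_ge0 h.
case: ltP => c1; [|case: ltP => c2].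
- by case: d => [[]|]; split=> //= H; [lra | exfalso; lra | exfalso; lra].
- by case: d => [[]|]; split=> //= H; [exfalso; lra | lra | exfalso; lra].
- by case: d => [[]|]; split=> //= H; [exfalso; lra | exfalso; lra | lra].
Qed.

Lemma cylinder_sub d h : cylinder (d :: h) `<=` cylinder h.
Proof.
move=> w; rewrite !cylinderE /=.
have [wq wq2] := widths_ge0 h.
by case: d => [[]|] /=; lra.
Qed.

(** The process is an arithmetic code: a sample point lies in a nested sequence
    of intervals, and its position in the current one decides the next draw.
    Within the unit interval, the events known at a given time are then finite
    unions of intervals. *)
Lemma history_cylinder h w : 0 <= w < 1 ->
  (history (size h) w = h) <-> cylinder h w.
Proof.
move=> w01; elim: h => [|d h IH] /=.
  by split=> // _; rewrite cylinderE /= add0r.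
split=> [[] + hE|c].
  by rewrite hE; move/IH: hE => c; move/(draw_cylinder _ c).
have c' := cylinder_sub c.
have -> := IH.2 c'; congr (_ :: _).
by apply/(draw_cylinder _ c').
Qed.

(** Intervals describe the history for the sample points of the unit interval
    only, whereas the sample space is the whole line; hence the induction. *)
Lemma measurable_history n h :
  measurable ([set w | history n w = h] : set (measurableTypeR R)).
Proof.
elim: n h => [|n IH] h /=.
  case: h => [|d h]; first by rewrite (_ : [set _ | _] = setT) //; apply/seteqP.
  by rewrite (_ : [set _ | _] = set0) //; apply/seteqP; split.
case: h => [|d h].
  by rewrite (_ : [set _ | _] = set0) //; apply/seteqP; split.
rewrite (_ : [set _ | _] =
  [set w | history n w = h] `&` draw h @^-1` [set d]); last first.
  by apply/seteqP; split=> w /= => [[<- ->]|[-> ->]].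
apply: measurableI => //.
have -> : draw h @^-1` [set d] = match d with
  | Some true => `]-oo, start h + width h * q h[
  | Some false => `[start h + width h * q h, start h + width h * (2 * q h)[
  | None => `[start h + width h * (2 * q h), +oo[ end.
  have [wq _] := widths_ge0 h.
  by apply/seteqP; split=> w; case: d => [[]|]; rewrite /= in_itv /= /draw;
    case: ltP => c1 //; (try case: ltP => c2 //);
    first [move=> H; exfalso; lra | move=> _; lra].
by case: d => [[]|].
Qed.

Lemma uniform_itv (a b : R) : 0 <= a -> a <= b -> b <= 1 ->
  P `[a, b[ = (b - a)%:E.
Proof.
move=> a0 ab b1; rewrite /uniform01 /= /uniform_prob.
rewrite (eq_integral (fun=> 1%:E)); last first.
  move=> x; rewrite inE /= in_itv /= => /andP[ax xb].
  by rewrite /uniform_pdf subr0 invr1 (le_trans a0 ax) ltW // (lt_le_trans xb b1).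
rewrite integral_cst //= mul1e lebesgue_measure_itv /= lte_fin.
by case: ltP => // ba; rewrite (_ : b = a) ?subrr //; apply/eqP; rewrite eq_le ba.
Qed.

Lemma cylinder_bounds h : 0 <= start h /\ start h + width h <= 1.
Proof.
elim: h => [|d h [IH1 IH2]] /=; first by rewrite add0r.
have [wq wq2] := widths_ge0 h.
by case: d => [[]|] /=; split; lra.
Qed.

Lemma prob_history h : P [set w | history (size h) w = h] = (width h)%:E.
Proof.
have p1 : P (~` `[0, 1[) = 0%E.
  by rewrite probability_setC // uniform_itv // subr0 subee.
have [b1 b2] := cylinder_bounds h.
transitivity (P (cylinder h)); last first.
  by rewrite uniform_itv // ?lerDl ?width_ge0 // addrC addKr.
have -> : cylinder h = [set w | history (size h) w = h] `&` `[0, 1[.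
  apply/seteqP; split=> w /=; rewrite in_itv /=.
    move=> c; have w01 : 0 <= w < 1.
      move: c; rewrite cylinderE => /andP[c1 c2].
      by rewrite (le_trans b1 c1) (lt_le_trans c2 b2).
    by split=> //; apply/history_cylinder.
  by case=> hw w01; apply/history_cylinder.
rewrite -[in LHS](setIT [set _ | _]) -(setUv `[0, 1[) setIUr.
rewrite [LHS]measureU0 //.
- by apply: measurableI => //; exact: measurable_history.
- by apply: measurableI => //; [exact: measurable_history | exact: measurableC].
apply/eqP; rewrite -measure_le0 -p1 le_measure // inE; last exact: measurableC.
by apply: measurableI => //; [exact: measurable_history | exact: measurableC].
Qed.

Fixpoint histories n : seq (seq (option bool)) :=
  if n is m.+1 then
    [seq d :: h | h <- histories m, d <- enum {: option bool}]
  else [:: [::]].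

Lemma mem_histories n h : (h \in histories n) = (size h == n).
Proof.
elim: n h => [|n IH] [|d h] //=.
  by apply/negbTE/allpairsPdep => -[? [? []]].
apply/allpairsPdep/idP => [[h' [d' [+ _ [_ ->]]]]|]; first by rewrite IH.
by rewrite eqSS -IH => hn; exists h, d; split=> //; rewrite mem_enum.
Qed.

Lemma uniq_histories n : uniq (histories n).
Proof.
elim: n => //= n IH; apply: allpairs_uniq => //; first exact: enum_uniq.
by move=> [h d] [h' d'] _ _ [-> ->].
Qed.

(** Conditional expectations given the past are computed by this finite sum. *)
Definition average (f : seq (option bool) -> R) h : R :=
  q h * f (Some true :: h) + q h * f (Some false :: h) +
  (1 - 2 * q h) * f (None :: h).

Lemma sum_histories n f :
  \sum_(h <- histories n.+1) f h * width h =
  \sum_(h <- histories n) average f h * width h.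
Proof.
rewrite /= big_allpairs_dep; apply: eq_bigr => h _.
rewrite big_enum /= (bigD1 (Some true)) //= (bigD1 (Some false)) //=.
rewrite (bigD1 None) //= big1; last by move=> [[]|].
rewrite /average; ring.
Qed.

(** A function of a bounded number of draws is a simple function, so its
    integral is a finite sum over histories. *)
Lemma comp_historyE n (f : seq (option bool) -> R) w :
  f (history n w) = \sum_(h <- histories n) f h * \1_[set w | history n w = h] w.
Proof.
rewrite (bigD1_seq (history n w)) ?uniq_histories ?mem_histories ?size_history //=.
rewrite indicE mem_set // mulr1 big1 ?addr0 // => h /eqP hw.
by rewrite indicE memNset ?mulr0 // => /= e; apply: hw.
Qed.

Lemma integrable_history n f :
  P.-integrable setT (fun w => (f (history n w))%:E).
Proof.
rewrite (_ : (fun _ => _) = fun w =>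
  \sum_(h <- histories n)
    ((f h)%:E * (\1_[set w | history n w = h] w)%:E)%E); last first.
  by apply/funext => w; rewrite comp_historyE -sumEFin.
apply: integrable_sum; first exact: measurableT.
move=> h _; apply: integrableZl; first exact: measurableT.
by apply: integrable_indic; exact: measurable_history.
Qed.

Lemma integral_history n f :
  (\int[P]_w (f (history n w))%:E = (\sum_(h <- histories n) f h * width h)%:E)%E.
Proof.
under eq_integral do rewrite comp_historyE -sumEFin.
under eq_integral do under eq_bigr do rewrite EFinM.
have ii h : P.-integrable setT (EFin \o \1_[set w | history n w = h]).
  by apply: integrable_indic; exact: measurable_history.
rewrite integral_sum; [|exact: measurableT|]; last first.
  by move=> h; apply: integrableZl; [exact: measurableT|exact: ii].
rewrite -sumEFin !big_seq; apply: eq_bigr => h; rewrite mem_histories => /eqP hn.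
rewrite integralZl; [|exact: measurableT|exact: ii].
rewrite integral_indic ?setIT; [|exact: measurableT|exact: measurable_history].
by rewrite EFinM -prob_history hn.
Qed.

(** The history takes countably many values, so the sigma-algebra that it
    generates contains the preimages of all sets of histories. *)
Definition past n : set_system R := [set A | exists B, A = history n @^-1` B].

(** An event of the past restricts the histories before the last draw; folding
    that restriction into [f] turns the integrals over the event into integrals
    over the whole space, where [sum_histories] applies. *)
Lemma tower_history n f A : past n A ->
  (\int[P]_(w in A) (average f (history n w))%:E =
   \int[P]_(w in A) (f (history n.+1 w))%:E)%E.
Proof.
move=> [B ->]; rewrite [LHS]integral_mkcond [RHS]integral_mkcond.
pose f' h := if behead h \in B then f h else 0.
have inB w : (w \in history n @^-1` B) = (history n w \in B).
  by apply/idP/idP; rewrite !inE.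
transitivity (\int[P]_w (average f' (history n w))%:E)%E.
  apply: eq_integral => w _; rewrite patchE inB /average /f' /=.
  by case: ifP => // _; rewrite !mulr0 !addr0.
rewrite integral_history -sum_histories -integral_history.
by apply: eq_integral => w _; rewrite patchE inB /f' /=; case: ifP.
Qed.

Lemma past_filtration : is_filtration (T := measurableTypeR R) past.
Proof.
split.
- move=> n; split.
  + by exists set0; rewrite preimage_set0.
  + by move=> A [B ->]; exists (~` B); rewrite setTD preimage_setC.
  + move=> A HA; exists (\bigcup_k (sval (cid (HA k)))).
    rewrite preimage_bigcup; apply: eq_bigcupr => k _; exact: (svalP (cid (HA k))).
- move=> n A [B ->].
  have -> : history n @^-1` B =
      \big[setU/set0]_(h <- histories n | h \in B) [set w | history n w = h].
    rewrite -bigcup_seq_cond; apply/seteqP; split=> w /=.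
      move=> Bw; exists (history n w) => //=.
      rewrite mem_histories size_history eqxx /=.
      by rewrite inE.
    by move=> [h /= /andP[_]]; rewrite inE => ? ->.
  by apply: bigsetU_measurable => h _; exact: measurable_history.
- move=> m n mn A [B ->]; exists [set h | B (drop (n - m)%N h)].
  apply/seteqP.
  have E w : drop (n - m) (history n w) = history m w.
    rewrite -{1 2}(subnKC mn) addnC addnK.
    by elim: (n - m)%N => [|k IH] //=; rewrite drop0.
  by split=> w /=; rewrite E.
Qed.

Lemma past_measurable n d' (U : measurableType d') (f : seq (option bool) -> U) :
  adapted_measurable (past n) (f \o history n).
Proof. by move=> B _; exists (f @^-1` B). Qed.

Lemma cond_exp_history n f :
  is_cond_exp P (past n) (f \o history n.+1) (average f \o history n).
Proof.
split; [exact: integrable_history.. | exact: past_measurable |].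
exact: tower_history.
Qed.

Lemma average_ge0 f h : (forall h, 0 <= f h) -> 0 <= average f h.
Proof.
move=> f0; rewrite /average; have := q_ge0 h; have := q_le h => ? ?.
by rewrite !addr_ge0 // mulr_ge0 //; lra.
Qed.

Lemma cond_exp_ge0_history n f : (forall h, 0 <= f h) ->
  is_cond_exp_ge0 P (past n) (f \o history n.+1) (EFin \o average f \o history n).
Proof.
move=> f0; split.
- split=> [|w]; last exact: f0.
  apply/measurable_EFinP; apply: measurable_int; exact: (integrable_history n.+1 f).
- by move=> w; rewrite lee_fin average_ge0.
- exact: (@past_measurable n _ _ (EFin \o average f)).
- exact: tower_history.
Qed.

Definition quiet (h : seq (option bool)) m := nseq m None ++ h.

Hypothesis q_quiet : forall h, exists2 c, 0 < c & forall m, c <= q (quiet h m).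

(** As the noise keeps probability at least [2 * c], each further noiseless step
    shrinks the probability of the quiet path by the factor [1 - 2 * c]. *)
Lemma width_quiet h c m : 0 <= c -> (forall m, c <= q (quiet h m)) ->
  width (quiet h m) <= (1 - 2 * c) ^+ m.
Proof.
move=> c0 qc; have w1 : width h <= 1.
  by have [? ?] := cylinder_bounds h; lra.
elim: m => [|m IH] /=; first by rewrite expr0.
rewrite exprSr -/(quiet h m); have := q_le (quiet h m); have := qc m => ? ?.
by apply: ler_pM => //; [exact: width_ge0|lra|lra].
Qed.

Lemma negligible_quiet h :
  P.-negligible [set w | forall m, history (m + size h) w = quiet h m].
Proof.
have [c c0 qc] := q_quiet h.
set A := [set w | _].
have AE : A = \bigcap_m [set w | history (m + size h) w = quiet h m].
  by apply/seteqP; split=> w /= H; [move=> m _ | move=> m]; exact: H.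
have mA : measurable A.
  by rewrite AE; apply: bigcap_measurable => // m _; exact: measurable_history.
have leA m : (P A <= ((1 - 2 * c) ^+ m)%:E)%E.
  apply: (@le_trans _ _ (width (quiet h m))%:E).
    rewrite -prob_history le_measure // ?inE //; first exact: measurable_history.
    by move=> w /(_ m) /=; rewrite size_cat size_nseq.
  by rewrite lee_fin width_quiet // ltW.
suff PA0 : fine (P A) <= 0.
  exists A; split => //; apply/eqP; rewrite -measure_le0.
  by rewrite -[leLHS]fineK ?lee_fin // fin_num_measure.
have c1 : `|1 - 2 * c| < 1.
  by rewrite ger0_norm; have := q_le h; have := qc 0%N; rewrite /quiet /=; lra.
apply: (@ler_cvg_to _ \oo _ _ (cst (fine (P A))) (fun m => (1 - 2 * c) ^+ m)).
- exact: cvg_cst.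
- exact: cvg_expr.
- by apply: nearW => m /=; rewrite -lee_fin fineK ?fin_num_measure //; exact: leA.
Qed.

(** If noise occurs finitely often, some history is followed by quiet steps
    only.  There are countably many histories, and for each of them this has
    probability zero. *)
Lemma infinitely_many_draws :
  {ae P, forall w, forall N, exists2 n, (N <= n)%N &
     history n.+1 w <> None :: history n w :> seq (option bool)}.
Proof.
pose Q k : set R := if unpickle k is Some h then
  [set w | forall m, history (m + size h) w = quiet h m] else set0.
have QE h : Q (pickle h) = [set w | forall m, history (m + size h) w = quiet h m].
  by rewrite /Q pickleK.
have Q0 k : P.-negligible (Q k).
  rewrite /Q; case: unpickle => [h|]; first exact: negligible_quiet.
  exact: negligible_set0.
apply: negligibleS (negligible_bigcup Q0) => w /= /existsNP[N HN].
exists (pickle (history N w)) => //; rewrite QE => m.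
rewrite size_history; elim: m => [|m IH] //=.
have [e|ne] := pselect (history (m + N).+1 w = None :: history (m + N) w).
  by rewrite [LHS]e IH.
by exfalso; apply: HN; exists (m + N)%N => //; rewrite leq_addl.
Qed.

End lazy_signs.

(** * The oracle and the path of AdaGrad-Norm *)

Section oracle.
Variables (R : realType) (p : R).

(** The pair [(x, s)] holds the current iterate and the sum of squared gradients
    before the step; the step size constant is one. *)
Definition adagrad_step (xs : R * R) (G : R) : R * R :=
  (xs.1 - G / Num.sqrt (xs.2 + G ^+ 2), xs.2 + G ^+ 2).

(** The noise has the size of the normalisation of the step, so it displaces
    the iterate by a constant distance however large the sum of squares is.  It
    is switched off away from the critical point, which keeps every path
    bounded; draws still take place there, without effect, so that their law
    depends on the sum of squares alone. *)
Definition kick (xs : R * R) : R :=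
  if `|xs.1| <= 1 / 4 then 2 * Num.sqrt xs.2 else 0.

Definition draw_sign (d : option bool) : R :=
  match d with Some true => 1 | Some false => -1 | None => 0 end.

Definition gradient (xs : R * R) d : R := xs.1 + draw_sign d * kick xs.

Fixpoint state (h : seq (option bool)) : R * R :=
  if h is d :: h' then adagrad_step (state h') (gradient (state h') d)
  else (0, 1).

Definition last_gradient (h : seq (option bool)) : R :=
  if h is d :: h' then gradient (state h') d else 0.

(** This is the rate at which a noise of size [2 * Num.sqrt s] has [p]-th moment
    of order one. *)
Definition kick_rate (h : seq (option bool)) : R :=
  (2 * Num.sqrt (state h).2) `^ (- p).

Lemma state_ge1 h : 1 <= (state h).2.
Proof. by elim: h => //= d h IH; rewrite (le_trans IH) // lerDl sqr_ge0. Qed.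

Lemma sqrt_ge1 (s : R) : 1 <= s -> 1 <= Num.sqrt s.
Proof. by move=> s1; rewrite -sqrtr1 ler_wsqrtr. Qed.

Lemma normalized_step_le1 (s G : R) :
  0 <= s -> `|G / Num.sqrt (s + G ^+ 2)| <= 1.
Proof.
move=> s0; rewrite normrM normfV (ger0_norm (sqrtr_ge0 _)).
have [->|G0] := eqVneq G 0; first by rewrite normr0 mul0r.
have G2 : 0 < G ^+ 2 by rewrite exprn_even_gt0.
rewrite ler_pdivrMr ?mul1r -?sqrtr_sqr ?ler_wsqrtr ?sqrtr_gt0 ?lerDr //.
by rewrite ltr_wpDl.
Qed.

Lemma descent_norm_le (x s : R) :
  1 <= s -> `|x - x / Num.sqrt (s + x ^+ 2)| <= `|x|.
Proof.
move=> s1; have b1 : 1 <= Num.sqrt (s + x ^+ 2).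
  by rewrite sqrt_ge1 // (le_trans s1) // lerDl sqr_ge0.
have i1 : (Num.sqrt (s + x ^+ 2))^-1 <= 1 by rewrite invf_le1 //; lra.
have i0 : 0 <= (Num.sqrt (s + x ^+ 2))^-1 by rewrite invr_ge0; lra.
rewrite -{1}[x]mulr1 -mulrBr normrM ler_piMr // ger0_norm; lra.
Qed.

Lemma state_bounded h : `|(state h).1| <= 5 / 4.
Proof.
elim: h => [|d h IH] /=; first by rewrite normr0; lra.
have s1 := state_ge1 h; move: IH s1; rewrite /gradient /kick.
case: (state h) => x s /= IH s1; case: ifPn => x4; last first.
  by rewrite mulr0 addr0; apply: le_trans IH; exact: descent_norm_le.
apply: (le_trans (ler_normB _ _)).
have s0 : 0 <= s by lra.
have := normalized_step_le1 (x + draw_sign d * (2 * Num.sqrt s)) s0; lra.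
Qed.

(** When [`|x| <= 1 / 4] and [1 <= s], the noise gives [Num.sqrt s <= `|G|], so
    the step is at least [1 / 2] long. *)
Lemma kick_escapes b (x s : R) : 1 <= s -> `|x| <= 1 / 4 ->
  1 / 4 <= `|(adagrad_step (x, s) (gradient (x, s) (Some b))).1|.
Proof.
move=> s1 x4; rewrite /gradient /kick /= x4.
have a1 := sqrt_ge1 s1; have s0 : 0 <= s by lra.
have : s = Num.sqrt s ^+ 2 by rewrite sqr_sqrtr.
move: (Num.sqrt s) a1 => a a1 ->.
set G := x + (if b then 1 else -1) * (2 * a).
have aG : a <= `|G|.
  rewrite /G {G}; case: b => /=; rewrite ?mul1r ?mulN1r; move: x4;
  rewrite ler_norml => /andP[? ?].
    by rewrite ger0_norm; lra.
  by rewrite ler0_norm; lra.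
have G0 : 0 < `|G| by lra.
have r0 : 0 < Num.sqrt (a ^+ 2 + G ^+ 2).
  by rewrite sqrtr_gt0 ltr_pwDl ?sqr_ge0 ?exprn_gt0 //; lra.
have r2 : Num.sqrt (a ^+ 2 + G ^+ 2) <= 2 * `|G|.
  have a2 : a ^+ 2 <= G ^+ 2.
    by rewrite -(real_normK (num_real G)) ler_pXn2r ?nnegrE //; lra.
  have -> : 2 * `|G| = Num.sqrt (2 ^+ 2 * G ^+ 2).
    by rewrite -exprMn sqrtr_sqr normrM ger0_norm.
  by rewrite ler_wsqrtr //; have := sqr_ge0 G; lra.
have : 1 / 2 <= `|G / Num.sqrt (a ^+ 2 + G ^+ 2)|.
  rewrite normrM normfV (gtr0_norm r0) ler_pdivlMr //; lra.
have := ler_normB x (x - G / Num.sqrt (a ^+ 2 + G ^+ 2)); rewrite subKr; lra.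
Qed.

(** A noiseless step [x' = x - x / b], with [b] the new square root of the sum and
    [a] the old one, decreases [x ^+ 2] by at least [x ^+ 2 / b], while
    [b - a = x ^+ 2 / (a + b)]. *)
Lemma quiet_potential (x s : R) : 1 <= s ->
  Num.sqrt (s + x ^+ 2) + (x - x / Num.sqrt (s + x ^+ 2)) ^+ 2 <=
  Num.sqrt s + x ^+ 2.
Proof.
move=> s1.
have a1 := sqrt_ge1 s1.
have b1 : Num.sqrt s <= Num.sqrt (s + x ^+ 2).
  by rewrite ler_wsqrtr // lerDl sqr_ge0.
have ea : Num.sqrt s ^+ 2 = s by rewrite sqr_sqrtr //; lra.
have eb : Num.sqrt (s + x ^+ 2) ^+ 2 = s + x ^+ 2.
  by rewrite sqr_sqrtr // addr_ge0 ?sqr_ge0 //; lra.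
move: (Num.sqrt s) (Num.sqrt (s + x ^+ 2)) a1 b1 ea eb => a b a1 ab ea eb.
have b0 : 0 < b by lra.
have x2 : x ^+ 2 = b ^+ 2 - a ^+ 2 by lra.
have -> : (x - x / b) ^+ 2 = x ^+ 2 * (1 - b^-1) ^+ 2 by field; lra.
have c0 : 0 < b^-1 by rewrite invr_gt0.
have c1 : b^-1 <= 1 by rewrite invf_le1 //; lra.
have -> : b + x ^+ 2 * (1 - b^-1) ^+ 2 = a + x ^+ 2 -
   (x ^+ 2 * (b^-1 * (1 - b^-1)) + (b - a) * a * b^-1).
  rewrite x2; field; lra.
have h1 : 0 <= x ^+ 2 * (b^-1 * (1 - b^-1)).
  by rewrite mulr_ge0 ?sqr_ge0 // mulr_ge0; lra.
have h2 : 0 <= (b - a) * a * b^-1.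
  by rewrite mulr_ge0 ?(ltW c0) // mulr_ge0; lra.
by rewrite gerBl addr_ge0.
Qed.

Lemma quiet_bounded h m :
  Num.sqrt (state (quiet h m)).2 + (state (quiet h m)).1 ^+ 2 <=
  Num.sqrt (state h).2 + (state h).1 ^+ 2.
Proof.
elim: m => [|m IH] //=; apply: le_trans IH; rewrite -/(quiet h m).
by rewrite /gradient /= mul0r addr0; exact: quiet_potential (state_ge1 _).
Qed.

Lemma kick_rate_ge0 h : 0 <= kick_rate h.
Proof. exact: powR_ge0. Qed.

Hypothesis hp : 2 < p.

(** On a quiet path the sum of squares stays bounded, hence so does the size of
    the noise, and its rate does not tend to zero. *)
Lemma kick_rate_quiet h :
  exists2 c, 0 < c & forall m, c <= kick_rate (quiet h m).
Proof.
set L := Num.sqrt (state h).2 + (state h).1 ^+ 2.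
have L1 : 1 <= L by rewrite (le_trans (sqrt_ge1 (state_ge1 h))) // lerDl sqr_ge0.
exists ((2 * L) `^ (- p)); first by rewrite powR_gt0; lra.
move=> m; rewrite /kick_rate !powRN lef_pV2 ?posrE ?powR_gt0 //; last 2 first.
- by lra.
- by have := sqrt_ge1 (state_ge1 (quiet h m)); lra.
have := sqrt_ge1 (state_ge1 (quiet h m)) => ?.
have p0 : 0 <= p by have := hp; lra.
apply: ge0_ler_powR; rewrite ?nnegrE ?mulr_ge0 //; try lra.
have := quiet_bounded h m; rewrite -/L.
by have := sqr_ge0 (state (quiet h m)).1; lra.
Qed.

(** This is where [p > 2] matters: a rate that keeps the [p]-th moment of order one
    keeps the second moment of order one as well. *)
Lemma kick_rate_sqr h : kick_rate h * (2 * Num.sqrt (state h).2) ^+ 2 <= 1.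
Proof.
have := sqrt_ge1 (state_ge1 h); rewrite /kick_rate; move: (Num.sqrt _) => a a1.
rewrite -powR_mulrn; last lra.
rewrite -powRD; last by apply/implyP => _; apply/lt0r_neq0; lra.
by rewrite -[leRHS](powRr0 (2 * a)) ler_powR; have := hp; lra.
Qed.

Lemma kick_rate_le h : 2 * kick_rate h <= 1.
Proof.
have := kick_rate_sqr h; have := sqrt_ge1 (state_ge1 h); have := kick_rate_ge0 h.
move: (Num.sqrt _) (kick_rate h) => a q q0 a1; apply: le_trans.
have : 0 <= q * (a ^+ 2 - 1) by rewrite mulr_ge0 // subr_ge0 exprn_ege1.
lra.
Qed.

Lemma mean_gradient h : average kick_rate last_gradient h = (state h).1.
Proof. rewrite /average /= /gradient /=; ring. Qed.

Lemma second_moment_gradient h :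
  average kick_rate (fun h => last_gradient h ^+ 2) h <= (state h).1 ^+ 2 + 2.
Proof.
have := kick_rate_sqr h; have := kick_rate_ge0 h.
rewrite /average /= /gradient /= /kick; move: (kick_rate h) => q q0.
case: (state h) => x s /=; case: ifP => _; lra.
Qed.

(** Each of the three outcomes contributes at most [2 `^ p].  For a noisy outcome
    the gradient is at most [2 * M], where [M] is the size of the noise, and
    [kick_rate h * M `^ p = 1]. *)
Lemma moment_gradient h :
  average kick_rate (fun h => `|last_gradient h| `^ p) h <= 3 * 2 `^ p.
Proof.
have := hp; have x2 := state_bounded h; have := sqrt_ge1 (state_ge1 h) => a1 p2.
have q0 := kick_rate_ge0 h; have q1 := kick_rate_le h.
set M := 2 * Num.sqrt (state h).2; have M2 : 2 <= M by rewrite /M; lra.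
have qM : kick_rate h * M `^ p = 1.
  by rewrite /kick_rate -/M powRN mulVf // lt0r_neq0 // powR_gt0; lra.
have k0 : 0 <= kick (state h) <= M by rewrite /kick /M; case: ifP => _; lra.
have bnd d : kick_rate h * `|gradient (state h) d| `^ p <= 2 `^ p.
  have -> : 2 `^ p = kick_rate h * (2 * M) `^ p.
    by rewrite powRM; [rewrite mulrCA qM mulr1|lra|lra].
  rewrite ler_wpM2l // ge0_ler_powR ?nnegrE //; [lra|lra|].
  rewrite /gradient; apply: (le_trans (ler_normD _ _)).
  have : `|draw_sign d * kick (state h)| <= M.
    rewrite normrM (ger0_norm (x := kick _)); last lra.
    by case: d => [[]|] /=; rewrite ?normrN ?normr1 ?normr0; lra.
  lra.
rewrite /average /=; have := bnd (Some true); have := bnd (Some false).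
suff : (1 - 2 * kick_rate h) * `|gradient (state h) None| `^ p <= 2 `^ p by lra.
have h2 : `|gradient (state h) None| `^ p <= 2 `^ p.
  rewrite ge0_ler_powR ?nnegrE //; [lra|].
  by rewrite /gradient /= mul0r addr0; lra.
apply: le_trans h2; rewrite ler_piMl ?powR_ge0 //; lra.
Qed.

End oracle.

(** * The objective and the counterexample *)

Section objective.
Variable R : realType.

Definition half_square (x : R) : R := x ^+ 2 / 2.

Lemma is_derive_half_square (x : R) : is_derive x 1 half_square x.
Proof.
rewrite (_ : half_square = fun x => x ^+ 2 / 2) //; apply: is_derive_eq.
by rewrite !scaler0 add0r /GRing.scale /= mulr1; field.
Qed.

Lemma derive_half_square : derive1 half_square = id.
Proof.
apply/funext => x; rewrite derive1E; have := is_derive_half_square x.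
by move=> ?; rewrite derive_val.
Qed.

Lemma half_square_coercive : coercive half_square.
Proof.
move=> B [M [_ MB]]; exists (`|M| + 2) => x Mx; apply: MB.
have M0 := normr_ge0 M; have MM := ler_norm M.
have x2 : 0 <= `|x| * (`|x| - 2) by rewrite mulr_ge0 //; lra.
rewrite /half_square -(real_normK (num_real x)); lra.
Qed.

Lemma liminf_id_pinfty :
  (0 < limf_einf (fun x : R => `|x|%:E) (norm_pinfty R))%E.
Proof.
rewrite /limf_einf lteNr oppe0; apply: (@le_lt_trans _ _ (- 1)%:E).
  2: by rewrite lte_fin ltrN10.
apply: ge_ereal_inf.
exists (ereal_sup ((fun x : R => - `|x|%:E)%E @` [set x | 1 < `|x|])).
  by exists [set x | 1 < `|x|] => //; exists 1.
by apply: ge_ereal_sup => _ [x x1 <-] /=; rewrite lee_fin lerN2 ltW.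
Qed.

Lemma critical_values_half_square : critical_values half_square = [set 0].
Proof.
rewrite /critical_values derive_half_square; apply/seteqP; split=> y /=.
  by move=> [x -> <-]; rewrite /half_square expr0n mul0r.
by move=> ->; exists 0; rewrite /half_square ?expr0n ?mul0r.
Qed.

Lemma nowhere_dense_set1 (x : R) : nowhere_dense [set x].
Proof.
by rewrite /nowhere_dense -(closure_id _).1 ?interior_set1.
Qed.

Lemma lipschitz_id : lipschitz (@id R).
Proof.
by exists 1; split=> // M M1 [x y] _ /=; rewrite ler_peMl // ltW.
Qed.

End objective.

Theorem proposition3 (R : realType) (p : R) (hp : 2 < p) :
  exists g : R -> R,
    (forall x, 0 <= g x) /\
    (forall x, derivable g x 1) /\
    continuous (derive1 g) /\
    lipschitz (derive1 g) /\
    coercive g /\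
    (0 < limf_einf (fun x : R => (`|derive1 g x|)%:E) (norm_pinfty R))%E /\
    nowhere_dense (critical_values g) /\
  exists theta1 S0 alpha0 delta0 : R,
    0 < S0 /\ 0 < alpha0 /\ 0 < delta0 /\
  exists (d : measure_display) (T : measurableType d) (P : probability T R)
         (F : nat -> set_system T) (G S theta : nat -> T -> R),
    is_filtration F /\
    adagrad_norm alpha0 S0 theta1 G S theta /\
    adapted_oracle F G S theta /\
    (* (a) *)
    (forall n, (1 <= n)%N ->
       is_cond_exp P (F n.-1) (G n) (fun w => derive1 g (theta n w))) /\
    (* (b) *)
    (exists beta sigma : R, 0 <= beta /\ 0 <= sigma /\
       forall n, (1 <= n)%N ->
         exists2 Y : T -> \bar R,
           is_cond_exp_ge0 P (F n.-1) (fun w => G n w ^+ 2) Y &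
           {ae P, forall w,
             (Y w <= (beta * `|derive1 g (theta n w)| ^+ 2 + sigma ^+ 2)%:E)%E}) /\
    (* (c) *)
    (exists C : R,
       forall n, (1 <= n)%N ->
         exists2 Y : T -> \bar R,
           is_cond_exp_ge0 P (F n.-1) (fun w => `|G n w| `^ p) Y &
           {ae P, forall w,
             `|derive1 g (theta n w)| <= delta0 -> (Y w <= C%:E)%E}) /\
    (exists M : R, forall n w, (1 <= n)%N -> `|theta n w| <= M) /\
    {ae P, forall w, ~ (derive1 g (theta n w) @[n --> \oo] --> (0 : R))}.
Proof.
exists (@half_square R); rewrite derive_half_square.
split; first by move=> x; rewrite /half_square divr_ge0 ?sqr_ge0.
split; first by move=> x; case: (is_derive_half_square x).
split; first by move=> x; exact: cvg_id.
split; first exact: lipschitz_id.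
split; first exact: half_square_coercive.
split; first exact: liminf_id_pinfty.
split; first by rewrite critical_values_half_square; exact: nowhere_dense_set1.
exists 0, 1, 1, 1; do 3 (split; first exact: ltr01).
pose q := @kick_rate R p.
have q0 : forall h, 0 <= q h := kick_rate_ge0 p.
have q1 : forall h, 2 * q h <= 1 := kick_rate_le hp.
pose H := history q.
exists _, _, (uniform01 R), (past q), (fun n w => last_gradient R (H n w)),
  (fun n w => (state R (H n w)).2), (fun n w => (state R (H n.-1 w)).1).
split; first exact: (past_filtration q0 q1).
split.
  split=> //.
  - by move=> [|n] w.
  - by move=> [|n] w // _; rewrite mul1r [_^-1 * _]mulrC.
split.
  split=> -[|n] // _.
  - exact: (past_measurable q n (fun h => (state R h).1)).
  - exact: (past_measurable q n (fun h => (state R h).2)).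
  - exact: (past_measurable q n.+1 (last_gradient R)).
split.
  move=> [|n] // _; have := cond_exp_history q0 q1 n (last_gradient R).
  rewrite (_ : average q _ = fun h => (state R h).1) //.
  by apply/funext => h; exact: mean_gradient.
split.
  exists 1, 2; do 2 split => //; move=> [|n] // _.
  exists (EFin \o average q (fun h => last_gradient R h ^+ 2) \o H n).
    by apply: (cond_exp_ge0_history q0 q1 n) => h; exact: sqr_ge0.
  apply: aeW => w /=; rewrite lee_fin mul1r real_normK ?num_real //.
  by apply: (le_trans (second_moment_gradient hp _)); rewrite lerD2l; lra.
split.
  exists (3 * 2 `^ p) => -[|n] // _.
  exists (EFin \o average q (fun h => `|last_gradient R h| `^ p) \o H n).
    by apply: (cond_exp_ge0_history q0 q1 n) => h; exact: powR_ge0.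
  by apply: aeW => w _ /=; rewrite lee_fin; exact: moment_gradient.
split; first by exists (5 / 4) => n w _; exact: state_bounded.
(* If the derivative tended to zero, the noise would be switched on from some
   time on, and the next noisy draw would move the iterate outside the
   neighbourhood of the critical point. *)
have always_draws := infinitely_many_draws q0 q1 (kick_rate_quiet hp).
apply: negligibleS always_draws => w; apply: contra_not => draws.
move=> /cvgr0Pnorm_lt /(_ (1 / 4)) small.
have [N _ Nsmall] :
    \forall n \near \oo, `|(state R (H n.-1 w)).1| < 1 / 4 :> R.
  by apply: small; lra.
have [n Nn] := draws N; apply.
(* The iterate of index n.+1 is the state of the history of length n. *)
have /= := Nsmall n.+1 (leqW Nn); have /= := Nsmall n.+2 (leqW (leqW Nn)).
have := state_ge1 R (H n w).
rewrite /H /=; case: (draw _ _ _) => [b|] //.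
case: (state R (history q n w)) => x s /= s1 /[swap] x4.
by rewrite ltNge (kick_escapes b s1) // ltW.
Qed.
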